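(* Let $M$ and $V$ be finite-dimensional real representation spaces of a finite group $\Gamma$. Let $\phi$ be a $\Gamma$-equivariant linear map from $M$ onto $V$. Suppose that $A\in\mathcal{A}(M)$, and assume that $V$ is a faithful representation of $\Gamma$. Let $k$ be a positive integer. If there is a point $a\in A$ such that $T(\{\phi(a)\})=\mathbf{1}$ (the trivial subgroup), then $$T(A)=\mathbf{1},$$ and there is an open dense subset $\mathcal{O}$ of $C^k_\Gamma(M)$ such that $$\Sigma(A)=\Sigma(\phi\circ\psi(A))\quad\text{for all }\psi\in\mathcal{O}.$$
   Context: A real representation space of a finite group $\Gamma$ is a real vector space with a linear action of $\Gamma$; it is faithful if the only $\gamma\in\Gamma$ with $\gamma x=x$ for all $x$ is $\gamma=1$. A map $f$ between spaces with $\Gamma$-actions is $\Gamma$-equivariant if $f(\gamma x)=\gamma f(x)$ for all $\gamma\in\Gamma$ and all $x$. For a subset $A$, $T(A)=\{\gamma\in\Gamma\mid \gamma x=x \ \forall x\in A\}$ and $\Sigma(A)=\{\gamma\in\Gamma\mid \gamma A=A\}$, where $\gamma A=\{\gamma x\mid x\in A\}$. Define $$\mathcal{A}(M)=\{A\subseteq M \mid A \text{ is compact and, for every } \gamma\in\Gamma,\ \gamma A=A \text{ or } \gamma A\cap A=\emptyset\}.$$ $C^k_\Gamma(M)$ is the set of $k$-times continuously differentiable $\Gamma$-equivariant maps $M\to M$, with the strong (Whitney) $C^k$ topology: a base of neighborhoods of $\psi$ is given by the sets $\{\tilde\psi\in C^k_\Gamma(M) \mid \|D^{(j)}\tilde\psi(x)-D^{(j)}\psi(x)\|<\varepsilon(x)\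 \forall x\in M,\ 0\le j\le k\}$, where $\varepsilon:M\to(0,\infty)$ ranges over continuous functions. *)

(* Defs.v *)
From HB Require Import structures.
From mathcomp Require Import all_boot all_order all_algebra all_fingroup.
From mathcomp Require Import mxrepresentation.
From mathcomp Require Import all_classical all_reals all_analysis.
Set Implicit Arguments.
Unset Strict Implicit.
Unset Printing Implicit Defensive.
Import Order.TTheory GRing.Theory Num.Theory.
Import numFieldNormedType.Exports.
Local Open Scope classical_set_scope.
Local Open Scope ring_scope.

(* A finite-dimensional real representation space of the finite group G is R^m
   with a matrix representation rM of G.  Since rM (g * h) = rM g *m rM h,
   letting rM g multiply column vectors on the left yields a left action. *)
Definition ract (R : realType) (gT : finGroupType) (G : {group gT}) (m : nat)
  (rM : mx_representation R G m) (g : gT) (x : 'cV[R]_m) : 'cV[R]_m :=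
  rM g *m x.

(* T(A) *)
Definition pointwise_stab (R : realType) (gT : finGroupType) (G : {group gT})
  (m : nat) (rM : mx_representation R G m) (A : set 'cV[R]_m) : {set gT} :=
  [set g in G | `[< forall x, A x -> ract rM g x = x >]]%SET.

(* Sigma(A) *)
Definition setwise_stab (R : realType) (gT : finGroupType) (G : {group gT})
  (m : nat) (rM : mx_representation R G m) (A : set 'cV[R]_m) : {set gT} :=
  [set g in G | `[< ract rM g @` A = A >]]%SET.

(* The family of sets written as a calligraphic A(M) *)
Definition admissible (R : realType) (gT : finGroupType) (G : {group gT})
  (m : nat) (rM : mx_representation R G m) : set (set 'cV[R]_m) :=
  [set A | compact A /\
    forall g, g \in G -> ract rM g @` A = A \/ ract rM g @` A `&` A = set0].

Definition equivariant (R : realType) (gT : finGroupType) (G : {group gT})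
  (m n : nat) (rM : mx_representation R G m) (rV : mx_representation R G n)
  (f : 'cV[R]_m -> 'cV[R]_n) : Prop :=
  forall g x, g \in G -> f (ract rM g x) = ract rV g (f x).

(* iter_diff f [:: v1; ...; vj] x is the j-th Frechet derivative of f at x,
   seen as a j-linear map and evaluated at (v1, ..., vj). *)
Definition iter_diff (R : realType) (U W : normedModType R)
  (f : U -> W) (vs : seq U) : U -> W :=
  foldr (fun v (h : U -> W) => fun x => 'd h x v) f vs.

(* As U is finite-dimensional where this is used, differentiability and
   continuity of a map into multilinear maps can be tested on each tuple of
   arguments. *)
Definition Ck_map (R : realType) (U W : normedModType R) (k : nat)
  (f : U -> W) : Prop :=
  (forall vs : seq U, (size vs < k)%N ->
     forall x, differentiable (iter_diff f vs) x) /\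
  (forall vs : seq U, size vs = k -> continuous (iter_diff f vs)).

(* Operator norm of a j-linear map *)
Definition multilinear_norm (R : realType) (U W : normedModType R) (j : nat)
  (L : j.-tuple U -> W) : R :=
  sup [set `|L v| | v in [set v : j.-tuple U | forall i, `|tnth v i| <= 1]].

Record CkG (R : realType) (gT : finGroupType) (G : {group gT}) (m : nat)
  (rM : mx_representation R G m) (k : nat) := MkCkG {
  CkG_fun :> 'cV[R]_m -> 'cV[R]_m ;
  CkG_Ck : Ck_map k CkG_fun ;
  CkG_equivariant : equivariant rM rM CkG_fun }.

Definition whitney_nbhd (R : realType) (gT : finGroupType) (G : {group gT})
  (m : nat) (rM : mx_representation R G m) (k : nat)
  (psi : CkG rM k) (eps : 'cV[R]_m -> R) : set (CkG rM k) :=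
  [set psi' | forall x (j : nat), (j <= k)%N ->
     multilinear_norm
       (fun v : j.-tuple 'cV[R]_m => iter_diff psi' v x - iter_diff psi v x)
     < eps x].

(* Open sets of the strong C^k topology: those containing a basic neighborhood
   of each of their points. *)
Definition whitney_open (R : realType) (gT : finGroupType) (G : {group gT})
  (m : nat) (rM : mx_representation R G m) (k : nat) : set (set (CkG rM k)) :=
  [set O | forall psi, O psi -> exists eps : 'cV[R]_m -> R,
     [/\ continuous eps, (forall x, 0 < eps x) & whitney_nbhd psi eps `<=` O]].

Section WhitneyTopology.
Variables (R : realType) (gT : finGroupType) (G : {group gT}) (m : nat).
Variables (rM : mx_representation R G m) (k : nat).

Lemma whitney_openT : whitney_open [set: CkG rM k].
Proof.
move=> psi _; exists (fun=> 1); split => //; first exact: cst_continuous.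
Qed.

Lemma whitney_openI (A B : set (CkG rM k)) :
  whitney_open A -> whitney_open B -> whitney_open (A `&` B).
Proof.
move=> oA oB psi [/oA[e1 [c1 p1 s1]] /oB[e2 [c2 p2 s2]]].
exists (fun x => Num.min (e1 x) (e2 x)); split.
- by move=> x; apply: continuous_min; [exact: c1|exact: c2].
- by move=> x; rewrite lt_min p1 p2.
- by move=> f fN; split; [apply: s1|apply: s2] => x j jk;
    have := fN x j jk; rewrite lt_min => /andP[].
Qed.

Lemma whitney_open_bigU (I : Type) (F : I -> set (CkG rM k)) :
  (forall i, whitney_open (F i)) -> whitney_open (\bigcup_i F i).
Proof.
move=> oF psi [i _ /oF[e [ce pe se]]]; exists e; split => // f /se ?.
by exists i.
Qed.

HB.instance Definition _ := gen_eqMixin (CkG rM k).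
HB.instance Definition _ := gen_choiceMixin (CkG rM k).
HB.instance Definition _ := isOpenTopological.Build (CkG rM k)
  whitney_openT whitney_openI whitney_open_bigU.

Lemma whitney_openE : @open (CkG rM k) = @whitney_open R gT G m rM k.
Proof. by []. Qed.

End WhitneyTopology.

(* Main.v *)
(* Besides being open, the set [O] of all [psi] such that no [g] outside
   [Sigma(A)] maps [phi (psi @` A)] into itself is dense.  Let [F] be a
   [G]-invariant function on [V], homogeneous of degree [#|G| - 1] and positive
   exactly at the points with trivial stabilizer.  First replace [psi x] by
   [psi x + t * bump x * x], where [bump] is an invariant bump function peaking
   at [a]: for small generic [t > 0], [F (phi (psi a)) > 0].  Then let [b]
   maximize [F \o phi \o psi] over [A] and multiply [psi] by [1 + s * bump],
   where [bump] now attains its maximum exactly on the orbit of [b].  The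
   points of [phi (psi @` A)] that maximize [F] are now the [h * phi (psi b)]
   with [h] in [Sigma(A)], and [phi (psi b)] has a trivial stabilizer; so if
   [g] maps the image into itself then [g] lies in [Sigma(A)]. *)
From HB Require Import structures.
Require Import Defs.
From mathcomp Require Import all_boot all_order all_algebra all_fingroup.
From mathcomp Require Import mxrepresentation.
From mathcomp Require Import all_classical all_reals all_analysis.
Set Implicit Arguments.
Unset Strict Implicit.
Unset Printing Implicit Defensive.
Import Order.TTheory GRing.Theory Num.Theory.
Import numFieldNormedType.Exports.
Local Open Scope classical_set_scope.
Local Open Scope ring_scope.

(* [fingroup] has another [ract], the restriction of an action. *)
Local Notation ract := Defs.ract.

(** * Calculus of C^k maps *)

Section CkCalculus.
Context {R : realType} {U : normedModType R}.
Implicit Types W : normedModType R.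

Lemma Ck_map0 W (f : U -> W) : Ck_map 0 f <-> continuous f.
Proof.
split=> [[_ /(_ [::] erefl)]//|cf]; split=> // vs /size0nil ->.
exact: cf.
Qed.

Lemma iter_diff_rcons W (f : U -> W) vs v :
  iter_diff f (rcons vs v) = iter_diff (fun x => 'd f x v) vs.
Proof. by rewrite /iter_diff foldr_rcons. Qed.

(** The last entry of [vs] is the direction of the innermost derivative, so splitting tuples at the
    end turns the definition into a recursion on [k]. The closure properties below are inductions
    through it. *)
Lemma Ck_mapS W k (f : U -> W) : Ck_map k.+1 f <->
  (forall x, differentiable f x) /\ forall v, Ck_map k (fun x => 'd f x v).
Proof.
split=> [[df cf]|[df cf]]; split.
- exact: (df [::]).
- move=> v; split=> vs hs; rewrite -iter_diff_rcons.
    by apply: df; rewrite size_rcons.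
  by apply: cf; rewrite size_rcons hs.
- case/lastP=> [|vs v]; first by [].
  rewrite size_rcons ltnS iter_diff_rcons => hs; exact: (cf v).1.
- case/lastP=> [|vs v]; first by [].
  by rewrite size_rcons iter_diff_rcons => -[hs]; exact: (cf v).2.
Qed.

Lemma Ck_map_continuous W k (f : U -> W) : Ck_map k f -> continuous f.
Proof.
case: k => [/Ck_map0//|k /Ck_mapS[df _] x].
exact: differentiable_continuous.
Qed.

Lemma Ck_map_pred W k (f : U -> W) : Ck_map k.+1 f -> Ck_map k f.
Proof.
elim: k f => [|k IHk] f; first by move/Ck_map_continuous/Ck_map0.
by move=> /Ck_mapS[df cf]; apply/Ck_mapS; split=> // v; apply: IHk.
Qed.

Lemma Ck_map_cst W k (c : W) : Ck_map k (cst c : U -> W).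
Proof.
elim: k c => [|k IHk] c; first exact/Ck_map0/cst_continuous.
apply/Ck_mapS; split=> [x|v]; first exact: differentiable_cst.
have -> : (fun x : U => 'd (fun=> c) x v) = fun=> 0 by
  apply/funext => x; rewrite (diff_cst c x).
exact: IHk.
Qed.

Lemma Ck_map_linear W k (f : {linear U -> W}) :
  continuous f -> Ck_map k f.
Proof.
move=> cf; case: k => [|k]; first exact/Ck_map0.
apply/Ck_mapS; split=> [x|v]; first exact: linear_differentiable.
have -> : (fun x : U => 'd f x v) = fun=> f v by
  apply/funext => x; rewrite diff_lin.
exact: Ck_map_cst.
Qed.

Lemma is_diffDZ W (f g : U -> W) (s : R) x :
  differentiable f x -> differentiable g x ->
  is_diff x (fun y => f y + s *: g y) (fun v => 'd f x v + s *: 'd g x v).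
Proof.
move=> /differentiableP df /differentiableP dg.
exact: (is_diffD df (is_diffZ s dg)).
Qed.

Lemma Ck_map_id k : Ck_map k (@idfun U).
Proof. by apply: (@Ck_map_linear _ k idfun) => x; exact: cvg_id. Qed.

Lemma Ck_mapDZ W k (f g : U -> W) (s : R) : Ck_map k f -> Ck_map k g ->
  Ck_map k (fun x => f x + s *: g x).
Proof.
elim: k f g => [|k IHk] f g.
  move=> /Ck_map0 cf /Ck_map0 cg; apply/Ck_map0 => x.
  by apply: cvgD; [exact: cf|apply: cvgZl_tmp; exact: cg].
move=> /Ck_mapS[df cf] /Ck_mapS[dg cg]; have dfg x := is_diffDZ s (df x) (dg x).
apply/Ck_mapS; split=> [x|v]; first by case: (dfg x).
have -> : (fun x : U => 'd (fun x => f x + s *: g x) x v) =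
    fun x => 'd f x v + s *: 'd g x v.
  by apply/funext => x; rewrite (@diff_val _ _ _ _ _ _ _ (dfg x)).
exact: IHk.
Qed.

Lemma iter_diffDZ W k (f g : U -> W) (s : R) vs : Ck_map k f -> Ck_map k g ->
  (size vs <= k)%N ->
  iter_diff (fun x => f x + s *: g x) vs =
  fun x => iter_diff f vs x + s *: iter_diff g vs x.
Proof.
elim/last_ind: vs k f g => [//|vs v IHvs] [|k] f g.
  by rewrite size_rcons.
rewrite size_rcons ltnS => /Ck_mapS[df cf] /Ck_mapS[dg cg] hs.
rewrite !iter_diff_rcons -(IHvs k)//; congr iter_diff.
apply/funext => x.
by rewrite (@diff_val _ _ _ _ _ _ _ (is_diffDZ s (df x) (dg x))).
Qed.

Lemma Ck_mapD W k (f g : U -> W) : Ck_map k f -> Ck_map k g ->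
  Ck_map k (fun x => f x + g x).
Proof.
move=> cf cg; have := Ck_mapDZ 1 cf cg; congr Ck_map.
by apply/funext => x; rewrite scale1r.
Qed.

Lemma Ck_map_sum W k (I : Type) (r : seq I) (P : pred I) (F : I -> U -> W) :
  (forall i, Ck_map k (F i)) -> Ck_map k (fun x => \sum_(i <- r | P i) F i x).
Proof.
move=> cF; elim: r => [|i r IHr].
  under eq_fun do rewrite big_nil; exact: Ck_map_cst.
under eq_fun do rewrite big_cons.
by case: (P i) => //; exact: Ck_mapD.
Qed.

Lemma is_diff_scale W (b : U -> R) (f : U -> W) x :
  differentiable b x -> differentiable f x ->
  is_diff x (fun y => b y *: f y) (fun v => b x *: 'd f x v + 'd b x v *: f x).
Proof.
move=> db df.
(* Scalar multiplication is packed as a bilinear map, so that the product rule becomes the chain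
   rule for [sB] after the pairing of [b] and [f]. *)
have bil : bilinear_for (GRing.Scale.Law.clone _ _ *:%R _)
    (GRing.Scale.Law.clone _ _ *:%R _) (@GRing.scale R W).
  split=> [u'|u] a y z /=; first by rewrite scalerDl scalerA.
  by rewrite scalerDr !scalerA mulrC.
pose sM := bilinear_isBilinear.Build R R W W _ _ (@GRing.scale R W) bil.
pose sB : {bilinear R -> W -> W} := HB.pack (@GRing.scale R W) sM.
have sc : continuous (fun p : R * W => sB p.1 p.2).
  exact: scale_continuous.
have -> : (fun y => b y *: f y) = (fun p => sB p.1 p.2) \o (fun y => (b y, f y)).
  by [].
have dp := differentiable_pair db df.
apply: DiffDef.
  by apply: differentiable_comp => //; apply: differentiable_bilin.
rewrite diff_comp//; last exact: differentiable_bilin.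
by rewrite diff_bilin// diff_pair.
Qed.

Lemma Ck_map_scale W k (b : U -> R) (f : U -> W) :
  Ck_map k b -> Ck_map k f -> Ck_map k (fun x => b x *: f x).
Proof.
elim: k b f => [|k IHk] b f.
  move=> /Ck_map0 cb /Ck_map0 cf; apply/Ck_map0 => x.
  by apply: cvgZ; [exact: cb|exact: cf].
(* The derivative given by the product rule involves [b] and [f] themselves, so their own [C^k]
   regularity is kept next to that of their differentials. *)
move=> cb' cf'; have cb := Ck_map_pred cb'; have cf := Ck_map_pred cf'.
move: cb' cf' => /Ck_mapS[db cdb] /Ck_mapS[df cdf].
have dbf x := is_diff_scale (db x) (df x).
apply/Ck_mapS; split=> [x|v]; first by case: (dbf x).
have -> : (fun x : U => 'd (fun x => b x *: f x) x v) =
    fun x => b x *: 'd f x v + 'd b x v *: f x.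
  by apply/funext => x; rewrite (@diff_val _ _ _ _ _ _ _ (dbf x)).
by apply: Ck_mapD; apply: IHk.
Qed.

Lemma Ck_map_prod k (I : Type) (r : seq I) (P : pred I) (F : I -> U -> R) :
  (forall i, Ck_map k (F i)) ->
  Ck_map k (fun x => \prod_(i <- r | P i) F i x).
Proof.
move=> cF; elim: r => [|i r IHr].
  under eq_fun do rewrite big_nil; exact: Ck_map_cst.
under eq_fun do rewrite big_cons.
by case: (P i) => //; exact: Ck_map_scale.
Qed.

End CkCalculus.

(** * Powers of the positive part *)

Section PositivePart.
Context {R : realType}.

Lemma continuous_max0X k : continuous (fun t : R => Num.max 0 t ^+ k).
Proof.
move=> t; apply: (@continuous_comp _ _ _ (Num.max (0 : R)) (fun t => t ^+ k)).
  by apply: continuous_max; [exact: cst_continuous|exact: cvg_id].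
exact: exprn_continuous.
Qed.

Lemma is_derive_max0X k (t : R) :
  is_derive t 1 (fun t : R => Num.max 0 t ^+ k.+2)
    (k.+2%:R * Num.max 0 t ^+ k.+1).
Proof.
have [t0|t0|->] := ltgtP t 0.
- apply: (@near_eq_is_derive _ _ _ (cst 0)).
    near=> y; rewrite /cst/= max_l ?expr0n//; apply/ltW.
    near: y; exact: lt_nbhsl.
  rewrite expr0n mulr0; exact: is_derive_cst.
- apply: (@near_eq_is_derive _ _ _ (fun y : R => y ^+ k.+2)).
    near=> y; rewrite max_r//; apply/ltW.
    near: y; exact: lt_nbhsr.
  apply: DeriveDef; first exact: exprn_derivable.
  by rewrite exp_derive [LHS]mulr1.
(* At 0 the difference quotient equals [Num.max 0 h ^+ k.+1] for either sign of [h], and tends to 0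
   because this exponent is positive. *)
- pose p (t : R) : R := Num.max 0 t ^+ k.+2.
  have h : (fun h : R => h^-1 *: ((p \o shift (0 : R)) (h *: (1 : R)) - p 0)) @ 0^'
      --> (0 : R).
    have cv : (fun h : R => Num.max 0 h ^+ k.+1) @ 0^' --> (0 : R).
      apply: cvg_within_filter; have := @continuous_max0X k.+1 0.
      by rewrite /continuous_at maxxx expr0n.
    apply: cvg_trans cv; apply: near_eq_cvg; near=> h.
    rewrite /p/= maxxx expr0n/= subr0 addr0 -[h *: 1]/(h * 1) mulr1 -[_ *: _]/(_ * _).
    have h0 : h != 0 by near: h; exact: nbhs_dnbhs_neq.
    have [hn|hp|/eqP] := ltgtP h 0; last by rewrite (negPf h0).
      by rewrite !expr0n mulr0.
    by rewrite [in RHS]exprS mulKf.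
  rewrite expr0n/= mulr0; apply: DeriveDef.
    by apply/cvg_ex; exists 0.
  exact: cvg_lim.
Unshelve. all: by end_near. Qed.

(** Each differentiation lowers the power of the positive part by one, so the exponent [k.+1] still
    leaves a continuous function after [k] derivatives. *)
Lemma Ck_map_max0X {U : normedModType R} k (u : U -> R) :
  (forall j, Ck_map j u) -> Ck_map k (fun x => Num.max 0 (u x) ^+ k.+1).
Proof.
move=> cu; elim: k => [|k IHk].
  apply/Ck_map0 => x.
  apply: (@continuous_comp _ _ _ u (fun t : R => Num.max 0 t ^+ 1)).
    exact: Ck_map_continuous (cu 0%N) _.
  exact: continuous_max0X.
pose p (t : R) : R := Num.max 0 t ^+ k.+2.
have /Ck_mapS[du cdu] := cu k.+1.
have dp t : differentiable p t.
  by apply/derivable1_diffP; case: (is_derive_max0X k t).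
apply/Ck_mapS; split=> [x|v].
  exact: (@differentiable_comp _ _ _ _ u p).
have -> : (fun x : U => 'd (fun x => Num.max 0 (u x) ^+ k.+2) x v) =
    fun x => Num.max 0 (u x) ^+ k.+1 *: (k.+2%:R *: 'd u x v).
  apply/funext => x; rewrite (@diff_comp _ _ _ _ u p)//= diff1E//.
  rewrite derive1E (@derive_val _ _ _ _ _ _ _ (is_derive_max0X k (u x))).
  by rewrite -[LHS]/(_ * _) -[RHS]/(_ * (_ * _)) mulrC -mulrA mulrCA.
apply: Ck_map_scale => //.
by apply: Ck_map_scale => //; exact: Ck_map_cst.
Qed.

End PositivePart.

(** * Compactness and linear maps on column vectors *)

Section ColumnVectors.
Context {R : realType}.

Lemma trmx_continuous m n : continuous (@trmx R m n).
Proof.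
move=> x t /= [P Px sPt]; exists (fun i j => P j i).
  by move=> i j; have := Px j i; rewrite mxE.
by move=> y Py; apply: sPt => i j; rewrite mxE; exact: Py.
Qed.

(** Transposition carries the ball to a closed bounded set of row vectors, where Heine-Borel
    applies. *)
Lemma compact_cV_ball m (r : R) : compact [set x : 'cV[R]_m | `|x| <= r].
Proof.
have [C C0 hC] := linear_lipschitz (@trmx_continuous m 1).
have -> : [set x : 'cV[R]_m | `|x| <= r] =
    trmx @` [set v : 'rV[R]_m | `|v^T| <= r].
  apply/seteqP; split=> [x xr|_ [v vr <-]//].
  by exists x^T; rewrite /= ?trmxK.
apply: continuous_compact.
  by apply: continuous_subspaceT; exact: trmx_continuous.
apply: bounded_closed_compact.
  exists (C * r); split=> [|M hM v /= vr]; first exact: num_real.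
  rewrite (le_trans _ (ltW hM))// -[v]trmxK (le_trans (hC _))//.
  by rewrite ler_pM2l.
have nc : continuous (fun v : 'rV[R]_m => `|v^T|).
  move=> v; apply: (@continuous_comp 'rV[R]_m 'cV[R]_m R trmx Num.norm).
    exact: trmx_continuous.
  exact: norm_continuous.
apply: (@closed_comp _ _ (fun v : 'rV[R]_m => `|v^T|) [set x | x <= r]).
  by move=> v _; exact: nc.
exact: closed_le.
Qed.

Lemma Ck_map_coord k m (i : 'I_m) : Ck_map k (fun x : 'cV[R]_m => x i 0).
Proof.
have lin : linear (fun x : 'cV[R]_m => x i 0 : R).
  by move=> a x y; rewrite !mxE.
pose fM := GRing.isLinear.Build _ _ _ _ _ lin.
pose f : {linear 'cV[R]_m -> R} := HB.pack (fun x : 'cV[R]_m => x i 0) fM.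
by apply: (@Ck_map_linear _ _ _ k f); exact: coord_continuous.
Qed.

Lemma linear_cV_sum m (W : lmodType R) (f : {linear 'cV[R]_m -> W}) x :
  f x = \sum_i x i 0 *: f (delta_mx i 0).
Proof.
rewrite {1}[x]matrix_sum_delta linear_sum.
by apply: eq_bigr => i _; rewrite big_ord1 linearZ.
Qed.

Lemma linear_cV_continuous m (W : normedModType R)
  (f : {linear 'cV[R]_m -> W}) : continuous f.
Proof.
have -> : f = (fun x => \sum_i x i 0 *: f (delta_mx i 0)) :> (_ -> _).
  by apply/funext => x; exact: linear_cV_sum.
apply: (@Ck_map_continuous _ _ _ 0); apply: Ck_map_sum => i.
apply: Ck_map_scale; first exact: Ck_map_coord.
exact: Ck_map_cst.
Qed.

Lemma ler_norm_coord m (x : 'cV[R]_m) i : `|x i 0| <= `|x|.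
Proof.
rewrite [leRHS]/Num.norm/= mx_normrE; apply/bigmax_geP; right => /=.
by exists (i, 0).
Qed.

End ColumnVectors.

(** * Derivatives of maps with bounded support *)

Section BoundedSupport.
Context {R : realType} {m : nat} {W : normedModType R}.
Local Notation U := 'cV[R]_m.
Implicit Types (f : U -> W) (r : R).

Lemma bounded_support_bounded f r : continuous f ->
  (forall x, r < `|x| -> f x = 0) -> exists2 C, 0 <= C & forall x, `|f x| <= C.
Proof.
move=> cf fr.
(* The radius [Num.max 0 r] keeps the ball nonempty even for negative [r]. *)
have [||c _ hc] := @compact_EVT_max _ R (fun x => `|f x|)
    [set x : U | `|x| <= Num.max 0 r] _ (@compact_cV_ball R m _).
- by exists 0; rewrite /= normr0 le_max lexx.
- apply: continuous_subspaceT => x.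
  apply: (@continuous_comp U W R f Num.norm); first exact: cf.
  exact: norm_continuous.
exists `|f c| => // x; have [xr|xr] := leP `|x| (Num.max 0 r).
  by apply: hc; rewrite inE.
by rewrite fr ?normr0//; move: xr; rewrite gt_max => /andP[].
Qed.

Lemma diff_bounded_support f r v : (forall x, differentiable f x) ->
  (forall x, r < `|x| -> f x = 0) -> forall x, r < `|x| -> 'd f x v = 0.
Proof.
move=> df fr x rx; rewrite -deriveE//.
rewrite (@near_eq_derive _ _ _ _ (cst 0)) ?derive_cst//.
near=> y; apply: fr; near: y.
exact: (@norm_continuous _ U x _ (lt_nbhsr rx)).
Unshelve. all: by end_near. Qed.

Lemma iter_diff_sumZ k n (c : 'I_n -> R) (F : 'I_n -> U -> W) vs (s : seq 'I_n) :
  (forall i, Ck_map k (F i)) -> (size vs <= k)%N ->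
  iter_diff (fun x => \sum_(i <- s) c i *: F i x) vs =
  fun x => \sum_(i <- s) c i *: iter_diff (F i) vs x.
Proof.
move=> cF hs; have cZ i : Ck_map k (fun x => c i *: F i x).
  by apply: (Ck_map_scale _ (cF i)); exact: Ck_map_cst.
elim: s => [|i s IHs].
  under eq_fun do rewrite big_nil; under [RHS]eq_fun do rewrite big_nil.
  elim/last_ind: vs hs => [//|vs v IHvs]; rewrite size_rcons => hs.
  rewrite iter_diff_rcons -[in RHS]IHvs; last exact: ltnW.
  by congr iter_diff; apply/funext => x; rewrite (diff_cst 0).
under eq_fun do rewrite big_cons addrC.
rewrite (iter_diffDZ _ (Ck_map_sum _ _ cZ) (cF i) hs) IHs.
by apply/funext => x; rewrite big_cons addrC.
Qed.

(** The bound is uniform in the directions: the innermost one is expanded in the standard basis,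
    with coefficients of absolute value at most 1, and induction bounds each of the finitely many
    basis derivatives. *)
Lemma iter_diff_bounded k f r j : Ck_map k f ->
  (forall x, r < `|x| -> f x = 0) -> (j <= k)%N ->
  exists2 C, 0 <= C & forall vs, size vs = j ->
    (forall v, v \in vs -> `|v| <= 1) -> forall x, `|iter_diff f vs x| <= C.
Proof.
elim: j k f => [|j IHj] k f cf fr.
  have [C C0 hC] := bounded_support_bounded (Ck_map_continuous cf) fr.
  by exists C => // vs /size0nil ->.
case: k cf => [//|k] /Ck_mapS[df cdf] jk.
have ex_ i : {C : R | 0 <= C & forall vs, size vs = j ->
    (forall v, v \in vs -> `|v| <= 1) ->
    forall x, `|iter_diff (fun x => 'd f x (delta_mx i 0)) vs x| <= C}.
  apply/cid2; apply: (IHj k) => //; exact: diff_bounded_support.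
pose C i := s2val (ex_ i).
exists (\sum_i C i); first by apply: sumr_ge0 => i _; exact: (s2valP (ex_ i)).
case/lastP => [//|vs v]; rewrite size_rcons => -[hs] hv x.
rewrite iter_diff_rcons.
have -> : (fun x => 'd f x v) =
    (fun x => \sum_i v i 0 *: 'd f x (delta_mx i 0)).
  by apply/funext => y; exact: linear_cV_sum.
rewrite (iter_diff_sumZ (k := k)) ?hs//.
apply: le_trans (ler_norm_sum _ _ _) _; apply: ler_sum => i _.
rewrite normrZ -[leRHS]mul1r; apply: ler_pM => //.
  apply: le_trans (ler_norm_coord _ _) _.
  by apply: hv; rewrite mem_rcons mem_head.
apply: (s2valP' (ex_ i)) => // w hw; apply: hv.
by rewrite mem_rcons inE hw orbT.
Qed.

Lemma iter_diff_bounded_support k f r vs : Ck_map k f ->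
  (forall x, r < `|x| -> f x = 0) -> (size vs <= k)%N ->
  forall x, r < `|x| -> iter_diff f vs x = 0.
Proof.
elim/last_ind: vs k f => [//|vs v IHvs] [|k] f; rewrite ?size_rcons//.
move=> /Ck_mapS[df cdf] fr hs; rewrite iter_diff_rcons.
by apply: (IHvs k) => //; exact: diff_bounded_support.
Qed.

End BoundedSupport.

(** * Perturbations in the strong topology *)

Section Perturbation.
Context {R : realType} {gT : finGroupType} {G : {group gT}} {m : nat}.
Context {rM : mx_representation R G m} {k : nat}.
Implicit Types psi eta : CkG rM k.

Lemma le_multilinear_norm (U W : normedModType R) j (L : j.-tuple U -> W) C :
  (forall v, (forall i, `|tnth v i| <= 1) -> `|L v| <= C) ->
  multilinear_norm L <= C.
Proof.
move=> hC; apply: ge_sup => [|_ [v hv <-]]; last exact: hC.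
exists `|L [tuple (0 : U) | i < j]|, [tuple (0 : U) | i < j] => // i.
by rewrite tnth_mktuple normr0.
Qed.

(** This is the case [j = 0]: the empty tuple is the only argument, so the supremum is taken over a
    single value. *)
Lemma whitney_nbhd_C0 psi psi' eps x :
  whitney_nbhd psi eps psi' -> `|psi' x - psi x| < eps x.
Proof.
move=> /(_ x 0%N isT); rewrite /multilinear_norm.
set S := (X in sup X); suff -> : S = [set `|psi' x - psi x|] by rewrite sup1.
apply/seteqP; split=> [_ [v _ <-]|_ ->]; first by rewrite (tuple0 v).
by exists [tuple] => // -[].
Qed.

Lemma equivariantDZ psi eta (s : R) :
  equivariant rM rM (fun x => psi x + s *: eta x).
Proof.
move=> g x gG; rewrite (CkG_equivariant psi)// (CkG_equivariant eta)//.
by rewrite /ract mulmxDr scalemxAr.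
Qed.

Definition CkG_perturb psi eta (s : R) : CkG rM k :=
  MkCkG (Ck_mapDZ s (CkG_Ck psi) (CkG_Ck eta)) (equivariantDZ psi eta s).

(** Outside a ball all derivatives of [eta] up to order [k] vanish. On the ball, which is compact,
    [eps] has a positive minimum and these derivatives have a common bound, so a small [s]
    suffices. *)
Lemma whitney_nbhd_perturb psi eta r (eps : 'cV[R]_m -> R) :
  (forall x, r < `|x| -> eta x = 0) ->
  continuous eps -> (forall x, 0 < eps x) ->
  exists2 d, 0 < d & forall s, `|s| < d ->
    whitney_nbhd psi eps (CkG_perturb psi eta s).
Proof.
move=> eta_r ceps eps0.
have [||c _ hc] := @compact_EVT_min _ R eps
    [set x | `|x| <= Num.max 0 r] _ (@compact_cV_ball R m _).
- by exists 0; rewrite /= normr0 le_max lexx.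
- exact: continuous_subspaceT.
have exC (j : 'I_k.+1) := cid2 (iter_diff_bounded (CkG_Ck eta) eta_r (ltn_ord j)).
pose C := \sum_j s2val (exC j).
have C0 : 0 <= C by apply: sumr_ge0 => j _; exact: (s2valP (exC j)).
have leC j : s2val (exC j) <= C.
  rewrite /C (bigD1 j)//= lerDl; apply: sumr_ge0 => i _.
  exact: (s2valP (exC i)).
have C1 : 0 < C + 1 by rewrite ltr_wpDl.
(* The divisor is [C + 1] because [C] may be 0. *)
exists (eps c / (C + 1)); first by rewrite divr_gt0.
move=> s; rewrite ltr_pdivlMr// => hs x j jk.
have diffE (v : j.-tuple 'cV[R]_m) :
    iter_diff (CkG_perturb psi eta s) v x - iter_diff psi v x =
    s *: iter_diff eta v x.
  rewrite (iter_diffDZ s (CkG_Ck psi) (CkG_Ck eta)) ?size_tuple//.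
  by rewrite addrC addKr.
have [xr|xr] := leP `|x| (Num.max 0 r); last first.
  apply: le_lt_trans (eps0 x); apply: le_multilinear_norm => v _.
  rewrite diffE (iter_diff_bounded_support (CkG_Ck eta) eta_r) ?size_tuple//.
    by rewrite scaler0 normr0.
  by move: xr; rewrite gt_max => /andP[].
have cx : eps c <= eps x by apply: hc; rewrite inE.
apply: lt_le_trans cx; apply: le_lt_trans hs; apply: le_multilinear_norm => v hv.
rewrite diffE normrZ ler_wpM2l//.
have jk1 : (j < k.+1)%N by [].
apply: le_trans (_ : C <= _); last by rewrite lerDl.
apply: le_trans (leC (Ordinal jk1)).
apply: (s2valP' (exC (Ordinal jk1))); first by rewrite size_tuple.
by move=> w /tnthP[i ->].
Qed.

Lemma open_perturb (U : set (CkG rM k)) psi eta r :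
  open U -> U psi -> (forall x, r < `|x| -> eta x = 0) ->
  exists2 d, 0 < d & forall s, `|s| < d -> U (CkG_perturb psi eta s).
Proof.
move=> oU /oU[eps [ceps eps0 epsU]] eta_r.
have [d d0 hd] := whitney_nbhd_perturb psi eta_r ceps eps0.
by exists d => // s /hd/epsU.
Qed.

End Perturbation.

(** * Invariant bump functions *)

Section Bump.
Context {R : realType} {gT : finGroupType} {G : {group gT}} {m : nat}.
Context (rM : mx_representation R G m).
Local Notation M := 'cV[R]_m.
Implicit Types (x p : M) (g h : gT).

Lemma ractM g h x : g \in G -> h \in G ->
  ract rM (g * h)%g x = ract rM g (ract rM h x).
Proof. by move=> gG hG; rewrite /ract repr_mxM// mulmxA. Qed.

Lemma ract1 x : ract rM 1%g x = x.
Proof. by rewrite /ract repr_mx1 mul1mx. Qed.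

Lemma ractK g x : g \in G -> ract rM g^-1%g (ract rM g x) = x.
Proof. by move=> gG; rewrite -ractM ?groupV// mulVg ract1. Qed.

Lemma ract_continuous g : continuous (ract rM g).
Proof. exact: (@linear_cV_continuous R m M (mulmx (rM g))). Qed.

(** The squared Euclidean norm is polynomial, hence smooth, unlike the sup norm. *)
Definition sqnorm x : R := \sum_i x i 0 ^+ 2.

Lemma sqnorm_ge0 x : 0 <= sqnorm x.
Proof. by apply: sumr_ge0 => i _; exact: sqr_ge0. Qed.

Lemma sqnorm_eq0 x : (sqnorm x == 0) = (x == 0).
Proof.
rewrite psumr_eq0 => [|i _]; last exact: sqr_ge0.
apply/allP/eqP => [x0|-> i _]; last by rewrite mxE expr0n eqxx.
apply/matrixP => i j; rewrite ord1 mxE.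
by have := x0 i (mem_index_enum _); rewrite sqrf_eq0 => /eqP.
Qed.

Lemma sqnorm_ge1 x : 1 < `|x| -> 1 <= sqnorm x.
Proof.
move=> x1; have xn0 : mx_norm x != 0 by rewrite gt_eqF// (lt_trans ltr01).
have [[i j] /= xij] := mx_norm_neq0 xn0; move: xij; rewrite ord1 => xi.
rewrite /sqnorm (bigD1 i)//=; apply: ler_wpDr.
  by apply: sumr_ge0 => l _; exact: sqr_ge0.
by rewrite -real_normK ?num_real// -xi expr_ge1// ltW// (lt_trans ltr01).
Qed.

(** A product over the group, instead of a minimum, stays polynomial. It is invariant by reindexing
    and vanishes exactly on the orbit of [p]. *)
Definition orbit_sqdist p x : R := \prod_(g in G) sqnorm (ract rM g x - p).

Lemma orbit_sqdist_ge0 p x : 0 <= orbit_sqdist p x.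
Proof. by apply: prodr_ge0 => g _; exact: sqnorm_ge0. Qed.

Lemma orbit_sqdist_ract p g x : g \in G ->
  orbit_sqdist p (ract rM g x) = orbit_sqdist p x.
Proof.
move=> gG; rewrite /orbit_sqdist [RHS](reindex_inj (mulIg g)).
apply: eq_big => [h|h hG]; first by rewrite groupMr.
by rewrite ractM.
Qed.

Lemma orbit_sqdist_eq0 p x :
  (orbit_sqdist p x == 0) = [exists g in G, x == ract rM g p].
Proof.
apply/prodf_eq0/existsP => -[g] => [gG|/andP[gG /eqP->]].
  rewrite sqnorm_eq0 subr_eq0 => /eqP gx; exists g^-1%g.
  by rewrite groupV gG -gx ractK//=.
exists g^-1%g; first by rewrite groupV.
by rewrite sqnorm_eq0 ractK// subrr.
Qed.

Lemma Ck_orbit_sqdist k p : Ck_map k (orbit_sqdist p).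
Proof.
apply: Ck_map_prod => g; apply: Ck_map_sum => i.
have c : Ck_map k (fun x => (ract rM g x - p) i 0).
  have -> : (fun x => (ract rM g x - p) i 0) =
      fun x => \sum_j rM g i j *: x j 0 + - p i 0.
    by apply/funext => x; rewrite !mxE.
  apply: Ck_mapD; last exact: Ck_map_cst.
  apply: Ck_map_sum => j; apply: Ck_map_scale; first exact: Ck_map_cst.
  exact: Ck_map_coord.
exact: (Ck_map_scale c c).
Qed.

Definition orbit_bump k p x : R := Num.max 0 (1 - orbit_sqdist p x) ^+ k.+1.

Lemma Ck_orbit_bump k p : Ck_map k (orbit_bump k p).
Proof.
apply: Ck_map_max0X => j.
have -> : (fun x => 1 - orbit_sqdist p x) =
    fun x => 1 + (-1) *: orbit_sqdist p x.
  by apply/funext => x; rewrite scaleN1r.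
by apply: Ck_mapDZ; [exact: Ck_map_cst|exact: Ck_orbit_sqdist].
Qed.

Lemma orbit_bump_ract k p g x : g \in G ->
  orbit_bump k p (ract rM g x) = orbit_bump k p x.
Proof. by move=> gG; rewrite /orbit_bump orbit_sqdist_ract. Qed.

Lemma orbit_bump_itv k p x : 0 <= orbit_bump k p x <= 1.
Proof.
have h : 0 <= Num.max 0 (1 - orbit_sqdist p x) <= 1.
  by rewrite le_max lexx ge_max ler01 gerBl orbit_sqdist_ge0.
case/andP: h => h0 h1.
by rewrite exprn_ge0//= exprn_ile1.
Qed.

Lemma orbit_bump_eq1 k p x :
  (orbit_bump k p x == 1) = [exists g in G, x == ract rM g p].
Proof.
rewrite -orbit_sqdist_eq0 /orbit_bump.
rewrite -[X in _ == X](expr1n _ k.+1) eqrXn2 ?le_max ?lexx//.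
have [d0|d0] := leP 0 (1 - orbit_sqdist p x).
  by rewrite subr_eq -[X in X == _]addr0 (inj_eq (addrI 1)) eq_sym.
rewrite eq_sym oner_eq0; apply/esym/negbTE.
by rewrite gt_eqF// (lt_trans ltr01)// -subr_lt0.
Qed.

Lemma orbit_bump_id k p : orbit_bump k p p = 1.
Proof.
apply/eqP; rewrite orbit_bump_eq1; apply/existsP; exists 1%g.
by rewrite group1 ract1/=.
Qed.

(** Since [x] is the image of [ract rM g x] under the inverse of [g], a large [x] has all its
    translates at distance more than 1 from [p]. Every factor of [orbit_sqdist] is then at least
    1. *)
Lemma orbit_bump_support k p :
  exists r, forall x, r < `|x| -> orbit_bump k p x = 0.
Proof.
have exC g := cid2 (linear_lipschitz
  (@linear_cV_continuous R m M (mulmx (rM g)))).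
pose C := \sum_g s2val (exC g).
have C_ge0 g : 0 <= s2val (exC g) by rewrite ltW// (s2valP (exC g)).
have leC g x : `|ract rM g x| <= C * `|x|.
  apply: le_trans (s2valP' (exC g) x) _; apply: ler_wpM2r => //.
  by rewrite /C (bigD1 g)//= lerDl; apply: sumr_ge0 => i _; exact: C_ge0.
exists (C * (1 + `|p|)) => x xr.
suff D1 : 1 <= orbit_sqdist p x.
  by rewrite /orbit_bump max_l ?expr0n// subr_le0.
rewrite /orbit_sqdist; elim/big_rec: _ => // g u gG u1.
apply: mulr_ege1 u1; apply: sqnorm_ge1.
have C0 : 0 < C.
  apply: lt_le_trans (s2valP (exC 1%g)) _.
  by rewrite /C (bigD1 1%g)//= lerDl; apply: sumr_ge0 => i _; exact: C_ge0.
have : C * (1 + `|p|) < C * `|ract rM g x|.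
  by apply: lt_le_trans xr _; rewrite -{1}[x](ractK x gG) leC.
rewrite ltr_pM2l// -ltrBrDr => /lt_le_trans; apply.
exact: lerB_dist.
Qed.

End Bump.

(** * An invariant function detecting trivial stabilizers *)

Section Regularity.
Context {R : realType} {gT : finGroupType} {G : {group gT}} {n : nat}.
Context (rV : mx_representation R G n).
Implicit Types (y : 'cV[R]_n) (g h : gT).

(* The outer sum makes the function [G]-invariant without any choice of an
   invariant norm. *)
Definition regularity y : R :=
  \sum_(h in G) \prod_(g in G^#%g) `|ract rV h y - ract rV g (ract rV h y)|.

Lemma regularity_ract g y : g \in G ->
  regularity (ract rV g y) = regularity y.
Proof.
move=> gG; rewrite /regularity [RHS](reindex_inj (mulIg g)).
apply: eq_big => [h|h hG]; first by rewrite groupMr.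
by apply: eq_bigr => g' _; rewrite ractM.
Qed.

Lemma ractZ g (c : R) y : ract rV g (c *: y) = c *: ract rV g y.
Proof. by rewrite /Defs.ract scalemxAr. Qed.

Lemma regularityZ (c : R) y :
  regularity (c *: y) = `|c| ^+ #|G^#%g| * regularity y.
Proof.
rewrite /regularity mulr_sumr; apply: eq_bigr => h _.
rewrite -prodr_const -big_split; apply: eq_bigr => g _ /=.
by rewrite !ractZ -scalerBr normrZ.
Qed.

(** If [g != 1] fixes [y], its conjugate by [h] fixes [ract rV h y], so every product has a zero
    factor. If only 1 fixes [y], the summand at [h = 1] is already positive. *)
Lemma regularity_gt0P y :
  reflect (forall g, g \in G -> ract rV g y = y -> g = 1%g)
    (0 < regularity y).
Proof.
apply: (iffP idP) => [y0 g gG gy|hy].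
  apply/eqP/negPn/negP => g1; move: y0; rewrite ltNge => /negP; apply.
  rewrite /regularity big1// => h hG; apply/eqP/prodf_eq0.
  exists (g ^ h^-1)%g; first by rewrite in_setD1 conjg_eq1 g1 groupJ ?groupV.
  rewrite normr_eq0 subr_eq0 -ractM ?groupJ ?groupV// conjgE invgK mulgA mulgKV.
  by rewrite ractM// gy.
rewrite /regularity (bigD1 1%g)//=; apply: ltr_pwDl.
  apply: prodr_gt0 => g; rewrite in_setD1 => /andP[g1 gG].
  rewrite ract1 normr_gt0 subr_eq0; apply: contra g1 => /eqP/esym gy.
  by rewrite (hy g).
by apply: sumr_ge0 => h _; apply: prodr_ge0.
Qed.

Lemma regularity_continuous : continuous regularity.
Proof.
apply/Ck_map0; apply: Ck_map_sum => h; apply: Ck_map_prod => g.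
apply/Ck_map0 => y.
apply: (@continuous_comp _ 'cV[R]_n R
  (fun y => ract rV h y - ract rV g (ract rV h y)) Num.norm).
  apply: continuousB; first exact: ract_continuous.
  apply: (@continuous_comp _ _ _ (ract rV h)); exact: ract_continuous.
exact: norm_continuous.
Qed.

End Regularity.

(** * Maps with an asymmetric image of [A] *)

Section AsymmetricImage.
Context {R : realType} {gT : finGroupType} {G : {group gT}} {m n : nat}.
Context {rM : mx_representation R G m} {rV : mx_representation R G n}.
Context {phi : {linear 'cV[R]_m -> 'cV[R]_n}}.
Context {A : set 'cV[R]_m} {k : nat}.
Context (phi_equiv : equivariant rM rV phi) (hA : admissible rM A).
Implicit Types (psi : CkG rM k) (g : gT).

Lemma admissible_setwise_stab g x : g \in G -> A x -> A (ract rM g x) ->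
  g \in setwise_stab rM A.
Proof.
move=> gG Ax Agx; rewrite inE gG; apply/asboolP.
have [//|/seteqP[gA0 _]] := hA.2 _ gG.
by have /gA0 : (ract rM g @` A `&` A) (ract rM g x) by split=> //; exists x.
Qed.

(** The condition denies an inclusion rather than an equality of sets: a single witness [x] then
    survives small perturbations of [psi]. *)
Definition moves_image g : set (CkG rM k) := [set psi |
  exists2 x, A x & forall x', A x' ->
    ract rV g (phi (psi x)) <> phi (psi x')].

(** By compactness of [A], the moved point has positive distance [F c] from the image. Only [C^0]
    closeness is needed to keep them apart, so a constant [eps] will do. *)
Lemma open_moves_image g : open (moves_image g).
Proof.
move=> psi [x Ax hx].
have [C C0 hC] := linear_lipschitz (@linear_cV_continuous _ _ _ phi).
have [D D0 hD] := linear_lipschitz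
  (@linear_cV_continuous _ _ _ (mulmx (rV g) : {linear 'cV[R]_n -> 'cV[R]_n})).
pose F x' := `|ract rV g (phi (psi x)) - phi (psi x')|.
have cF : continuous F.
  move=> y; apply: (@continuous_comp _ 'cV[R]_n R
    (fun y => ract rV g (phi (psi x)) - phi (psi y)) Num.norm).
    apply: continuousB; first exact: cst_continuous.
    apply: (@continuous_comp _ _ _ psi).
      exact: Ck_map_continuous (CkG_Ck psi) y.
    exact: linear_cV_continuous.
  exact: norm_continuous.
have [|c] := @compact_EVT_min _ R F A _ hA.1 (continuous_subspaceT cF).
  by exists x.
rewrite inE => Ac hc; have Fc0 : 0 < F c.
  by rewrite normr_gt0 subr_eq0; apply/eqP/hx.
(* Chosen so that the displacements of the two points, below [D * (C * e)] and [C * e], add up to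
   less than [F c]. *)
pose e := F c / ((D + 1) * C).
have e0 : 0 < e by rewrite divr_gt0// mulr_gt0// addr_gt0.
exists (fun=> e); split=> [|//|psi' hpsi']; first exact: cst_continuous.
exists x => // x' Ax' eqx.
have lip y : `|phi (psi' y) - phi (psi y)| < C * e.
  rewrite -linearB; apply: le_lt_trans (hC _) _; rewrite ltr_pM2l//.
  exact: (whitney_nbhd_C0 y hpsi').
suff : F c < F c by rewrite ltxx.
have {2}-> : F c = D * (C * e) + C * e.
  rewrite /e -[X in _ + X]mul1r -mulrDl mulrA mulrC divfK//.
  by rewrite gt_eqF// mulr_gt0// addr_gt0.
apply: le_lt_trans (hc x' _) _; first by rewrite inE.
rewrite {1}/F.
have -> : ract rV g (phi (psi x)) - phi (psi x') =
    - ract rV g (phi (psi' x) - phi (psi x)) + (phi (psi' x') - phi (psi x')).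
  by rewrite /Defs.ract mulmxBr opprB addrA -eqx subrK.
apply: le_lt_trans (ler_normD _ _) _; rewrite normrN.
apply: ltrD; last exact: lip.
by apply: le_lt_trans (hD _) _; rewrite ltr_pM2l.
Qed.

Definition asymmetric_image : set (CkG rM k) := [set psi |
  forall g, g \in G -> g \notin setwise_stab rM A -> moves_image g psi].

Lemma open_asymmetric_image : open asymmetric_image.
Proof.
rewrite openE => psi hpsi.
(* The group is finite, so it is enough to treat one [g] at a time. *)
suff H g : nbhs psi [set psi' | g \in G ->
    g \notin setwise_stab rM A -> moves_image g psi'].
  exact: (@filter_forall _ gT _ (nbhs psi) _ H).
have [[gG gA]|ng] := pselect (g \in G /\ g \notin setwise_stab rM A);
    last first.
  by apply: (filterS _ (@filterT _ (nbhs psi) _)) => psi' _ gG gA; case: ng.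
have : nbhs psi (moves_image g).
  by apply: open_nbhs_nbhs; split; [exact: open_moves_image|exact: hpsi].
by apply: filterS => psi' hpsi' _ _.
Qed.

(** Elements of [setwise_stab rM A] preserve the image by equivariance; any other element of [G]
    moves some point of the image out of it. *)
Lemma setwise_stab_image psi : asymmetric_image psi ->
  setwise_stab rM A = setwise_stab rV ((phi \o psi) @` A).
Proof.
move=> hpsi; apply/setP => g.
have [gA|gA] := boolP (g \in setwise_stab rM A); last first.
  apply/esym/negP; rewrite inE => /andP[gG /asboolP gK].
  have [x Ax hx] := hpsi g gG gA.
  have : ((phi \o psi) @` A) (ract rV g (phi (psi x))).
    by rewrite -gK; exists (phi (psi x)) => //; exists x.
  by case=> x' Ax' /esym/hx; apply.
move: gA; rewrite !inE => /andP[gG /asboolP gA]; rewrite gG; apply/esym/asboolP.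
have E x : ract rV g ((phi \o psi) x) = (phi \o psi) (ract rM g x).
  by rewrite /= CkG_equivariant// phi_equiv.
apply/seteqP; split=> [_ [_ [x Ax <-] <-]|_ [x + <-]].
  by rewrite E; exists (ract rM g x) => //; rewrite -gA; exists x.
rewrite -{1}gA => -[x' Ax' <-]; rewrite -E.
by exists ((phi \o psi) x') => //; exists x'.
Qed.

Lemma bump_equivariant p (f : 'cV[R]_m -> 'cV[R]_m) : equivariant rM rM f ->
  equivariant rM rM (fun x => orbit_bump rM k p x *: f x).
Proof.
by move=> hf g x gG; rewrite orbit_bump_ract// hf// ractZ.
Qed.

Definition CkG_bump p psi : CkG rM k :=
  MkCkG (Ck_map_scale (Ck_orbit_bump rM k p) (CkG_Ck psi))
    (bump_equivariant p (@CkG_equivariant _ _ _ _ _ _ psi)).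

Lemma CkG_bump_support p psi :
  exists r, forall x, r < `|x| -> CkG_bump p psi x = 0.
Proof.
have [r hr] := orbit_bump_support rM k p.
by exists r => x /hr xr; rewrite /= xr scale0r.
Qed.

Definition CkG_id : CkG rM k := MkCkG (Ck_map_id k) (fun g x _ => erefl).

(* [y + t z] can be fixed by a given [g] for one value of [t] at most. *)
Lemma regular_near y z : (0 : R) < regularity rV z ->
  \forall t \near (0 : R)^'+, 0 < regularity rV (y + t *: z).
Proof.
move=> /regularity_gt0P hz.
suff H : \forall t \near (0 : R)^'+, forall g,
    g \in G -> ract rV g (y + t *: z) = y + t *: z -> g = 1%g.
  by near=> t; apply/regularity_gt0P; near: t.
apply: filter_forall => g.
have [gG|gG] := boolP (g \in G); last by apply: nearW => t /negP.
(* Either [g] fixes the point for no positive [t], or for some [t0]; a second value [t < t0] would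
   make [g] fix the difference [(t0 - t) *: z], hence [z]. *)
have [[t0 [t0_gt0 gt0]]|] := pselect (exists t0,
    0 < t0 /\ ract rV g (y + t0 *: z) = y + t0 *: z); last first.
  move=> hN; near=> t.
  have t_gt0 : 0 < t by near: t; exact: nbhs_right_gt.
  by move=> _ gt; exfalso; apply: hN; exists t.
near=> t.
have tt0 : t < t0 by near: t; exact: nbhs_right_lt.
move=> _ gt; apply: hz => //.
have t0t : t0 - t != 0 by rewrite subr_eq0 gt_eqF.
apply: (scalerI t0t); rewrite -ractZ scalerBl.
have -> : t0 *: z - t *: z = (y + t0 *: z) - (y + t *: z).
  by rewrite opprD addrACA subrr add0r.
by rewrite /Defs.ract mulmxBr -/(ract rV g _) -/(ract rV g _) gt0 gt.
Unshelve. all: by end_near. Qed.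

Lemma dense_asymmetric_image a : A a -> 0 < regularity rV (phi a) ->
  dense asymmetric_image.
Proof.
move=> Aa phia U [psi Upsi] oU.
have [r1 hr1] := CkG_bump_support a CkG_id.
have [d1 d1_gt0 hd1] := open_perturb oU Upsi hr1.
have [t [td reg_t]] : exists t, `|t| < d1 /\
    0 < regularity rV (phi (psi a) + t *: phi a).
  near (0 : R)^'+ => t; exists t; split; last first.
    by near: t; exact: regular_near.
  rewrite gtr0_norm; near: t; [exact: nbhs_right_lt|exact: nbhs_right_gt].
pose psi1 := CkG_perturb psi (CkG_bump a CkG_id) t.
have Upsi1 : U psi1 by exact: hd1.
(* The bump is 1 at [a], so [phi (psi1 a)] is [phi (psi a) + t *: phi a]. *)
have phipsi1 : 0 < regularity rV (phi (psi1 a)).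
  by rewrite /= orbit_bump_id scale1r linearD linearZ.
pose F x := regularity rV (phi (psi1 x)).
have cF : continuous F.
  move=> y; apply: (@continuous_comp _ _ _ (fun y => phi (psi1 y))).
    apply: (@continuous_comp _ _ _ psi1).
      exact: Ck_map_continuous (CkG_Ck psi1) y.
    exact: linear_cV_continuous.
  exact: regularity_continuous.
have [|b] := @compact_EVT_max _ R F A _ hA.1 (continuous_subspaceT cF).
  by exists a.
rewrite inE => Ab hb.
have Fb : 0 < F b by apply: lt_le_trans phipsi1 (hb _ _); rewrite inE.
have [r2 hr2] := CkG_bump_support b psi1.
have [d2 d2_gt0 hd2] := open_perturb oU Upsi1 hr2.
pose s := d2 / 2; have s_gt0 : 0 < s by rewrite divr_gt0.
pose psi2 := CkG_perturb psi1 (CkG_bump b psi1) s.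
exists psi2; split.
  by apply: hd2; rewrite gtr0_norm// /s ltr_pdivrMr// ltr_pMr// ltr1n.
pose c x := 1 + s * orbit_bump rM k b x.
have psi2E x : psi2 x = c x *: psi1 x.
  by rewrite /c scalerDl scale1r -scalerA.
have regE x : regularity rV (phi (psi2 x)) = `|c x| ^+ #|G^#%g| * F x.
  by rewrite -regularityZ psi2E linearZ.
have cb : c b = 1 + s by rewrite /c orbit_bump_id mulr1.
have c_ge1 x : 1 <= c x.
  rewrite /c lerDl mulr_ge0 ?(ltW s_gt0)//.
  by case/andP: (orbit_bump_itv rM k b x).
(* The same maximum point [b] serves as witness for every [g]. *)
move=> g gG gA; exists b => // x Ax eqbx.
have g1 : g != 1%g.
  apply: contra gA => /eqP->; apply: (@admissible_setwise_stab 1%g b) => //.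
  by rewrite ract1.
(* A positive degree of homogeneity is what makes the comparison of powers below strict. *)
have G_gt0 : (0 < #|G^#%g|)%N by apply/card_gt0P; exists g; rewrite in_setD1 g1.
have : orbit_bump rM k b x == 1.
  apply/negPn/negP => bump_neq1.
  have cxb : c x < c b.
    rewrite cb /c ltrD2l gtr_pMr// lt_neqAle bump_neq1.
    by case/andP: (orbit_bump_itv rM k b x).
  have := regE x; rewrite -eqbx regularity_ract// regE => E.
  suff : `|c x| ^+ #|G^#%g| * F x < `|c b| ^+ #|G^#%g| * F b by rewrite E ltxx.
  rewrite !ger0_norm; try exact: le_trans (c_ge1 _).
  have cx0 : 0 <= c x by exact: le_trans (c_ge1 _).
  apply: (@le_lt_trans _ _ (c x ^+ #|G^#%g| * F b)).
    apply: ler_wpM2l; first exact: exprn_ge0.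
    by apply: hb; rewrite inE.
  by rewrite (ltr_pM2r Fb) ltrXn2r// -lt0n.
rewrite orbit_bump_eq1 => /existsP[h /andP[hG /eqP xE]].
have hstab : h \in setwise_stab rM A.
  by apply: (@admissible_setwise_stab h b) => //; rewrite -xE.
suff /eqP : (h^-1 * g)%g = 1%g.
  by rewrite -eq_mulVg1 => /eqP hg; rewrite -hg hstab in gA.
have /regularity_gt0P : 0 < regularity rV (phi (psi2 b)).
  rewrite regE mulr_gt0// exprn_gt0// normr_gt0 gt_eqF//.
  exact: lt_le_trans (c_ge1 _).
apply; first by rewrite groupM ?groupV.
rewrite ractM ?groupV// eqbx xE CkG_equivariant// phi_equiv//.
exact: ractK.
Unshelve. all: by end_near. Qed.

End AsymmetricImage.

Theorem corollary1p16 (R : realType) (gT : finGroupType) (G : {group gT})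
  (m n : nat) (rM : mx_representation R G m) (rV : mx_representation R G n)
  (phi : {linear 'cV[R]_m -> 'cV[R]_n})
  (phi_equiv : equivariant rM rV phi)
  (phi_onto : range phi = [set: 'cV[R]_n])
  (A : set 'cV[R]_m) (hA : admissible rM A)
  (V_faithful : mx_faithful rV)
  (k : nat) (k_gt0 : (0 < k)%N)
  (ha : exists2 a, A a & pointwise_stab rV [set phi a] = 1%g) :
  pointwise_stab rM A = 1%g /\
  exists O : set (CkG rM k),
    [/\ open O, dense O &
        forall psi : CkG rM k, O psi ->
          setwise_stab rM A = setwise_stab rV ((phi \o psi) @` A)].
Proof.
have [a Aa stab_a] := ha.
have regular_a g : g \in G -> ract rV g (phi a) = phi a -> g = 1%g.
  move=> gG ga; apply/set1gP; rewrite -stab_a inE gG.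
  by apply/asboolP => _ ->.
split.
  apply/setP => g; apply/idP/set1gP => [|->].
    rewrite inE => /andP[gG /asboolP gA]; apply: regular_a => //.
    by rewrite -phi_equiv// gA.
  by rewrite inE group1; apply/asboolP => x _; rewrite ract1.
exists (asymmetric_image (rM := rM) (rV := rV) (phi := phi) (A := A) (k := k)).
split; [exact: open_asymmetric_image| |].
  by apply: (dense_asymmetric_image phi_equiv hA Aa); exact/regularity_gt0P.
by move=> psi; exact: setwise_stab_image.
Qed.
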